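(* Fix $r>0$. Let $(X,d,\mu)$ be a metric measure space such that $(X,d)$ has the equal radius Besicovitch intersection property with constant $E=E(X,d)<\infty$, and let $\{\mu_{x,r}\}_{x\in X}$ be a filter adapted to $\mu$, with constant $M<\infty$. Then for every $1\le p<\infty$ and every locally integrable function $g$ on $X$, $$\|g*\mu_{\cdot,r}\|_{L^p(\mu)}\le M\,\Big(\sup_{x\in X}\mu(B(x,r))\Big)\,E^{1/p}\,\|g\|_{L^p(\mu)},$$ and $$\|g*\mu_{\cdot,r}\|_{L^\infty(\mu)}\le M\,\Big(\sup_{x\in X}\mu(B(x,r))\Big)\,\|g\|_{L^\infty(\mu)}.$$
   Context: Balls. In a metric space $(X,d)$, $B^{o}(x,r)=\{y: d(x,y)<r\}$ and $B^{cl}(x,r)=\{y: d(x,y)\le r\}$. The notation $B(x,r)$ means that all balls considered are of the same kind, i.e. all open or all closed; the result holds for either choice. Metric measure space. A Borel measure $\mu$ is $\tau$-additive if for every collection $\{U_\alpha:\alpha\in\Lambda\}$ of open sets, $\mu(\bigcup_\alpha U_\alpha)=\sup \mu(\bigcup_{i=1}^n U_{\alpha_i})$, the supremum being over all finite subcollections. $(X,d,\mu)$ is a metric measure space if $\mu$ is a $\tau$-additive (nonnegative) Borel measure on the metric space $(X,d)$ which assigns finite measure to bounded Borel sets. Equal radius Besicovitch intersection property. A ball is a set of points, which may have several centers and radii. A collection $\mathcal C$ of balls is a Besicovitch family if for each $B\in\mathcal C$ one can choose a center and a radius such that whenever $B_1,B_2\in\mathcal C$ are distinct balls, neither contains the chosen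 center of the other. Let $\mathcal E(X,d)$ be the collection of all families $\mathcal C$ for which such a choice of centers and radii can be made making $\mathcal C$ a Besicovitch family with, in addition, all chosen radii equal (the common radius may depend on $\mathcal C$). Set $$E(X,d)=\sup\Big\{\sum_{B\in\mathcal C}\mathbf 1_{B}(y): y\in X,\ \mathcal C\in\mathcal E(X,d)\Big\}.$$ $(X,d)$ has the equal radius Besicovitch intersection property with constant $E(X,d)$ if $E(X,d)<\infty$. (The value of the constant is the same for open balls and for closed balls.) Filters. For fixed $r>0$, a filter is a collection $\{\mu_{x,r}\}_{x\in X}$ where, for each $x\in X$, $\mu_{x,r}$ is a signed $\tau$-additive Borel measure on the ball $B(x,r)$. Its total variation (sum of positive and negative parts) is $|\mu_{x,r}|$. The filter is adapted to $\mu$ with constant $M<\infty$ if for all $x,y\in X$ and all $0<s\le r$, $$|\mu_{x,r}|\big(B(y,s)\cap B(x,r)\big)\le M\,\mu\big(B(y,s)\cap B(x,r)\big).$$ Convolution with a filter. $g*\mu_{\cdot,r}$ is the function $x\mapsto g*\mu_{x,r}:=\int_{B(x,r)} g(y)\,d\mu_{x,r}(y)$. Conventions. Locally integrable is understood as: $g$ is $\mu$-measurable and $\int_B|g|\,d\mu<\infty$ for every ball $B$. The convention $0\cdot\infty=0$ is used, and norms may equal $+\infty$. If $x\mapsto g*\mu_{x,r}$ is not measurable, its $L^p(\mu)$ norm is understood via the upper integral (and its $L^\infty(\mu)$ norm as the infimum of those $c\ge 0$ such that the set where its absolute value exceeds $c$ is contained in a $\mu$-null set); for measurable functions these are the usual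 norms. *)

(* Defs.v *)
From HB Require Import structures.
From mathcomp Require Import all_boot all_order all_algebra.
From mathcomp Require Import all_classical all_reals all_analysis.
From mathcomp Require Import measurable_realfun.

Set Implicit Arguments.
Unset Strict Implicit.
Unset Printing Implicit Defensive.

Import Order.TTheory GRing.Theory Num.Theory.
Import numFieldNormedType.Exports.

Local Open Scope classical_set_scope.
Local Open Scope ring_scope.

(* Measurable types are pointed in the library, hence so are the metric spaces
   considered here; the only content of the point is that X is nonempty. *)
#[short(type="pmetricType")]
HB.structure Definition PointedMetric (K : numDomainType) :=
  { M of Pointed M & Metric K M }.

Definition borel (R : realType) (X : pmetricType R) :=
  g_sigma_algebraType (@open X).

Section balls.
Context (R : realType) (X : pmetricType R).

Variant ball_kind := OpenBalls | ClosedBalls.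

Definition mball (k : ball_kind) (x : X) (s : R) : set X :=
  match k with
  | OpenBalls => [set y | mdist x y < s]
  | ClosedBalls => [set y | mdist x y <= s]
  end.

(* [c] and [rho] choose a center and a radius of each ball of [C]; exchanging
   [B1] and [B2] in the last clause shows that neither ball contains the
   chosen center of the other. *)
Definition besicovitch_choice (k : ball_kind) (C : set (set X))
    (c : set X -> X) (rho : set X -> R) :=
  (forall B, C B -> 0 < rho B /\ B = mball k (c B) (rho B)) /\
  (forall B1 B2, C B1 -> C B2 -> B1 <> B2 -> ~ B2 (c B1)).

Definition equal_radius_besicovitch_family (k : ball_kind) (C : set (set X)) :=
  exists (c : set X -> X) (rho : set X -> R),
    besicovitch_choice k C c rho /\
    exists rho0, forall B, C B -> rho B = rho0.

End balls.

Section definitions.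
Context (R : realType) (X : pmetricType R).
Local Open Scope ereal_scope.

Definition equal_radius_besicovitch_constant (k : ball_kind) : \bar R :=
  ereal_sup [set z : \bar R | exists (y : X) (C : set (set X)),
    equal_radius_besicovitch_family k C /\
    z = \esum_(B in C) (\1_B y : R)%:E].

Definition tau_additive (m : set X -> \bar R) :=
  forall U : set (set X), (forall A, U A -> open A) ->
    m (\bigcup_(A in U) A) =
    ereal_sup [set m (\bigcup_(A in F) A) | F in fsets U].

Definition metric_measure (mu : {measure set (borel X) -> \bar R}) :=
  tau_additive mu /\
  forall A : set (borel X), measurable A ->
    (exists (x : X) (s : R), A `<=` mball ClosedBalls x s) -> mu A < +oo.

Section jordan.
Variable nu : {charge set (borel X) -> \bar R}.

Definition hahn_pos : set (borel X) := sval (cid (Hahn_decomposition nu)).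

Definition hahn_neg : set (borel X) :=
  sval (cid (svalP (cid (Hahn_decomposition nu)))).

Lemma hahn_posneg : hahn_decomposition nu hahn_pos hahn_neg.
Proof. exact: svalP (cid (svalP (cid (Hahn_decomposition nu)))). Qed.

Definition pos_part : {measure set (borel X) -> \bar R} :=
  jordan_pos hahn_posneg.

Definition neg_part : {measure set (borel X) -> \bar R} :=
  jordan_neg hahn_posneg.

Definition charge_total_variation : set (borel X) -> \bar R :=
  charge_variation hahn_posneg.

Definition charge_integral (B : set (borel X)) (g : X -> R) : \bar R :=
  \int[pos_part]_(y in B) (g y)%:E - \int[neg_part]_(y in B) (g y)%:E.

End jordan.

(* A signed Borel measure on the subspace B(x,r) is represented by its extension
   by zero to X, i.e. by a signed measure on X concentrated on B(x,r). Charges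
   are finite signed measures; this is no restriction, as a signed measure
   satisfying [adapted] has finite total variation as soon as bounded sets have
   finite mu-measure. A signed measure is tau-additive when its total variation
   (equivalently, its positive and negative parts) is. *)
Definition signed_ball_filter (k : ball_kind) (r : R)
    (nu : X -> {charge set (borel X) -> \bar R}) :=
  forall x : X,
    (forall A : set (borel X), measurable A ->
       nu x A = nu x (A `&` mball k x r)) /\
    tau_additive (charge_total_variation (nu x)).

Definition adapted (k : ball_kind) (r : R)
    (mu : {measure set (borel X) -> \bar R})
    (nu : X -> {charge set (borel X) -> \bar R}) (M : R) :=
  forall (x y : X) (s : R), (0 < s <= r)%R ->
    charge_total_variation (nu x) (mball k y s `&` mball k x r) <=
    M%:E * mu (mball k y s `&` mball k x r).

Definition convolution (k : ball_kind) (r : R)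
    (nu : X -> {charge set (borel X) -> \bar R}) (g : X -> R) (x : X) : \bar R :=
  charge_integral (nu x) (mball k x r) g.

(* mu-measurable: measurable for the mu-completion of the Borel sets. The library
   integral (hence also the library Lnorm) is defined for arbitrary functions, as
   a supremum over Borel simple functions below the positive and negative parts;
   on functions measurable for the completion it is the integral with respect to
   the completed measure. *)
Definition completion_measurable (mu : {measure set (borel X) -> \bar R})
    (g : X -> R) :=
  forall V : set R, measurable V ->
    @completed_algebra_gen _ (borel X) R mu (g @^-1` V).

Definition locally_integrable_on_balls (k : ball_kind)
    (mu : {measure set (borel X) -> \bar R}) (g : X -> R) :=
  completion_measurable mu g /\
  forall (x : X) (s : R), (0 < s)%R ->
    \int[mu]_(y in mball k x s) `|(g y)%:E| < +oo.

Definition upper_integral (mu : {measure set (borel X) -> \bar R})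
    (f : X -> \bar R) : \bar R :=
  ereal_inf [set \int[mu]_x h x | h in [set h : borel X -> \bar R |
    measurable_fun [set: borel X] h /\ forall x, 0 <= h x /\ f x <= h x]].

Definition upper_Lp_norm (mu : {measure set (borel X) -> \bar R}) (p : R)
    (f : X -> \bar R) : \bar R :=
  upper_integral mu (fun x => `|f x| `^ p) `^ p^-1.

Definition upper_Loo_norm (mu : {measure set (borel X) -> \bar R})
    (f : X -> \bar R) : \bar R :=
  ereal_inf [set c%:E | c in [set c : R |
    (0 <= c)%R /\ mu.-negligible [set x : borel X | c%:E < `|f x|]]].

Definition sup_ball_measure (k : ball_kind) (r : R)
    (mu : {measure set (borel X) -> \bar R}) : \bar R :=
  ereal_sup [set mu (mball k x r) | x in [set: X]].

End definitions.

Arguments equal_radius_besicovitch_constant {R} X k.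

(* Main.v *)
Require Import Defs.
From HB Require Import structures.
From mathcomp Require Import all_boot all_order all_algebra.
From mathcomp Require Import all_classical all_reals all_analysis.
From mathcomp Require Import measurable_realfun ess_sup_inf lra.

Set Implicit Arguments.
Unset Strict Implicit.
Unset Printing Implicit Defensive.

Import Order.TTheory GRing.Theory Num.Theory.
Import numFieldNormedType.Exports.

Local Open Scope classical_set_scope.
Local Open Scope ring_scope.
Local Open Scope ereal_scope.

(** Let [M'] be the maximum of [M] and 0. The theorem rests on the pointwise bound
    [`|g * nu x| <= M' * \int_(B(x, r)) `|g| dmu], which follows once the total
    variation of [nu x] is at most [M' * mu] on all Borel sets
    ([filter_domination]). The definition of an adapted filter gives this
    comparison on small balls only, and two measures on a metric space may be
    comparable on balls without being so on Borel sets. The equal radius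
    Besicovitch property closes this gap ([ball_domination]).

    Let [lam] be a finite measure with [lam B <= M' * mu B] on small balls, and
    suppose that [lam >= a * mu] on all subsets of a bounded set [A], with
    [a > M']. A small ball centered in [A] cannot be mostly filled by [A], so its
    [lam]-measure is at most a constant times the [mu]-measure of its part
    outside [A] ([ball_deficit]). Take an open [U] containing [A] with
    [mu (U `\` A)] small ([borel_outer_regular]), and cover the points of [A]
    that are far from the complement of [U] by balls of one small radius about a
    maximal separated set. These balls form a Besicovitch family, hence overlap
    at most [E] times, and summing bounds [lam A] by a constant times
    [E * mu (U `\` A)] ([covering_estimate]). Thus [lam A = 0]
    ([dominating_set_null]), and a Hahn decomposition of [lam - a * mu] yields
    [lam <= a * mu] for every [a > M'].

    The separated sets must be countable for [lam] to be summed over the cover,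
    and [X] need not be separable; but tau-additivity of [mu] makes it
    concentrated on the closure of a countable set ([separable_full_measure]),
    and tau-additivity of [lam] makes the complement [lam]-null as well.

    Given the pointwise bound, the estimate for the essential supremum is
    immediate. For finite [p], Hoelder's inequality on the ball and Tonelli's
    theorem for the symmetric kernel [d (x, y) < r] (or [<= r]) give the
    constant [M' * S] with [S] the supremum of the measures of the balls of
    radius [r] ([integral_ball_average_le], [convolution_Lp_le]), and
    [1 <= E `^ p^-1] since a single ball is a Besicovitch family. The kernel is
    replaced by a product-measurable one with the same sections over a set of
    full measure ([ball_kernel]). Finally [M' * S = M * S], for a negative [M]
    forces [S = 0]; and [g], measurable for the completion, may be taken Borel
    ([completion_measurable_borel]), since the null sets of [mu] are null for
    every [nu x]. *)

(** * Balls and Borel sets of a metric space *)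

Section borel_metric.
Context (R : realType) (X : pmetricType R).
Implicit Types (x y z : X) (s t : R) (U : set X).

Lemma open_mball x s : open (mball OpenBalls x s).
Proof.
rewrite openE => y /= dxy; apply/nbhs_ballP.
exists (s - mdist x y)%R => /=; first by rewrite subr_gt0.
move=> z; rewrite ballEmdist /= ltrBrDl => dyz.
exact: le_lt_trans (metric_triangle x y z) dyz.
Qed.

Lemma open_mdist_gt x s : open [set y : X | s < mdist x y]%R.
Proof.
rewrite openE => y /= dxy; apply/nbhs_ballP.
exists (mdist x y - s)%R => /=; first by rewrite subr_gt0.
move=> z; rewrite ballEmdist /= ltrBrDl => dyz.
have := metric_triangle x z y; rewrite (metric_sym z y); lra.
Qed.

Lemma open_borel U : open U -> measurable (U : set (borel X)).
Proof. exact: sub_sigma_algebra. Qed.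

Lemma closed_borel U : closed U -> measurable (U : set (borel X)).
Proof.
move=> cU; rewrite -(setCK U); apply: measurableC.
by apply: open_borel; rewrite openC.
Qed.

Lemma measurable_mball k x s : measurable (mball k x s : set (borel X)).
Proof.
case: k; first by apply: open_borel; exact: open_mball.
apply: closed_borel; rewrite -openC.
rewrite (_ : ~` _ = [set y : X | s < mdist x y]%R); first exact: open_mdist_gt.
by apply/seteqP; split => y /=; rewrite ltNge => /negP.
Qed.

Lemma mball_center k x s : (0 < s)%R -> mball k x s x.
Proof. by case: k => s0 /=; rewrite mdistxx // ltW. Qed.

Lemma mball_sym k x y s : mball k x s y = mball k y s x.
Proof. by case: k; rewrite /= metric_sym. Qed.

Lemma sub_mball_closed k x s : mball k x s `<=` mball ClosedBalls x s.
Proof. by case: k => y //=; exact: ltW. Qed.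

Lemma sub_open_mball k x s : mball OpenBalls x s `<=` mball k x s.
Proof. by case: k => y //=; exact: ltW. Qed.

(** Besicovitch families of one radius are used below, and in general no single
    radius keeps all balls centered in an open set inside that set. The points at
    distance at least [t] from the complement admit every radius less than
    [t], and they exhaust the open set as [t] decreases. *)
Definition inner_core U t : set X :=
  [set y | forall z, ~ U z -> (t <= mdist y z)%R].

Lemma closed_inner_core U t : closed (inner_core U t).
Proof.
rewrite (_ : inner_core U t =
    ~` \bigcup_(z in ~` U) [set y : X | mdist z y < t]%R).
  by apply: open_closedC; apply: bigcup_open => z _; exact: open_mball.
apply/seteqP; split => [y yU [z Uz /=]|y yU z Uz].
  by rewrite metric_sym ltNge => /negP; apply; exact: yU.
by rewrite leNgt; apply/negP => yz; apply: yU; exists z => //=; rewrite metric_sym.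
Qed.

Lemma sub_inner_core U s t : (s <= t)%R -> inner_core U t `<=` inner_core U s.
Proof. by move=> st y Uy z /Uy; exact: le_trans. Qed.

Lemma bigcup_inner_core U : open U ->
  \bigcup_n inner_core U n.+1%:R^-1 = U.
Proof.
move=> oU; apply/seteqP; split => [y [n _ nU]|y Uy].
  apply: contrapT => /nU; rewrite mdistxx leNgt => /negP; apply.
  by rewrite invr_gt0.
move: oU; rewrite openE => /(_ _ Uy) /nbhs_ballP[e /= e0 eU].
have [n ne] : exists n, (n.+1%:R^-1 < e)%R.
  by have [n _ /(_ n (leqnn n)) ne] := near_infty_natSinv_lt (PosNum e0); exists n.
exists n => // z Uz; rewrite leNgt; apply/negP => yz; apply: Uz; apply: eU.
by rewrite ballEmdist /=; exact: lt_trans yz ne.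
Qed.

Lemma nondecreasing_inner_core U :
  nondecreasing_seq (fun n => inner_core U n.+1%:R^-1).
Proof.
move=> n m nm; apply/subsetPset; apply: sub_inner_core.
by rewrite lef_pV2 ?posrE// ler_nat.
Qed.

Lemma mball_sub_core k U y s t : inner_core U t y -> (s < t)%R ->
  mball k y s `<=` U.
Proof.
move=> Uy st z /sub_mball_closed/= yz; apply: contrapT => /Uy ty.
by move: (lt_le_trans st ty); rewrite ltNge yz.
Qed.

End borel_metric.

(** * Regularity of Borel measures on a metric space *)

Lemma nonincreasing_measure_lt d (T : measurableType d) (R : realType)
    (m : {measure set T -> \bar R}) (F : (set T)^nat) (e : \bar R) :
  m (F 0%N) < +oo -> (forall i, measurable (F i)) -> nonincreasing_seq F ->
  m (\bigcap_n F n) < e -> exists n, m (F n) < e.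
Proof.
move=> F0 mF niF.
have mcap : measurable (\bigcap_n F n) by exact: bigcapT_measurable.
have cvF := nonincreasing_cvg_mu F0 mF mcap niF.
have ni : {homo (m \o F) : a b / (a <= b)%N >-> b <= a}.
  by move=> a b ab /=; apply: le_measure; rewrite ?inE//; apply/subsetPset/niF.
rewrite -(cvg_lim _ cvF)// (cvg_lim _ (ereal_nonincreasing_cvgn ni))//.
by move=> /ereal_inf_lt[_ [n _ <-] ?]; exists n.
Qed.

Section regularity.
Context (R : realType) (X : pmetricType R).

(** Outer regularity alone is not visibly stable under complements. The class of
    sets approximated by closed sets from inside and by open sets from outside
    is, and it contains the open sets because an open set of a metric space is
    the union of its inner cores. *)
Lemma borel_closed_open_approx (m : {finite_measure set (borel X) -> \bar R})
    (A : set (borel X)) (e : R) : measurable A -> (0 < e)%R ->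
  exists F U : set X, [/\ closed F, open U, F `<=` A, A `<=` U &
    m (U `\` F) < e%:E].
Proof.
pose P (A : set X) := forall e : R, (0 < e)%R ->
  exists F U : set X, [/\ closed F, open U, F `<=` A, A `<=` U &
    m (U `\` F) < e%:E].
have mfin (B : set (borel X)) : measurable B -> m B < +oo.
  by move=> mB; rewrite ltey_eq fin_num_measure.
suff : <<s @open X >> `<=` P by move=> sP /sP; apply.
move=> {A e}.
apply: smallest_sub; last first.
  move=> U oU e e0.
  pose F n : set (borel X) := inner_core U n.+1%:R^-1.
  have cF n : closed (F n : set X) by exact: closed_inner_core.
  have mU : measurable (U : set (borel X)) by exact: open_borel.
  have mUF n : measurable (U `\` F n : set (borel X)).
    by apply: measurableD => //; exact: closed_borel.
  have [|a b ab||n mn] := @nonincreasing_measure_lt _ _ _ m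
    (fun n => U `\` F n) e%:E _ mUF.
  - exact: mfin.
  - by apply/subsetPset; apply: setDS; apply/subsetPset;
      exact: nondecreasing_inner_core.
  - rewrite (_ : \bigcap_n _ = set0) ?measure0 ?lte_fin//.
    rewrite -subset0 => x capx; have [Ux _] := capx 0%N I.
    by move: Ux; rewrite -{1}(bigcup_inner_core oU) => -[i _]; have [] := capx i I.
  exists (F n), U; split => //.
  by rewrite -[X in _ `<=` X](bigcup_inner_core oU); exact: bigcup_sup.
split.
- move=> e e0; exists set0, set0; split => //.
  + exact: closed0.
  + exact: open0.
  + by rewrite setD0 measure0 lte_fin.
- move=> A PA e /PA[F [U [cF oU FA AU mUF]]]; exists (~` U), (~` F); split.
  + exact: open_closedC.
  + exact: closed_openC.
  + by rewrite setTD; exact: subsetC.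
  + by rewrite setTD; exact: subsetC.
  + by rewrite setDE setCK setIC -setDE.
- move=> A PA e e0.
  have e2 i : (0 < e / 2 / (2 ^ i.+1)%:R)%R by rewrite !divr_gt0// ltr0n expn_gt0.
  have /choice[F /choice[U FU]] := fun i => PA i _ (e2 i).
  have cF i : closed (F i) by have [] := FU i.
  have oU i : open (U i) by have [] := FU i.
  have mUF i : measurable (U i `\` F i : set (borel X)).
    by apply: measurableD; [exact: open_borel|exact: closed_borel].
  pose V : set (borel X) := \bigcup_i U i.
  pose H n : set (borel X) := \big[setU/set0]_(i < n) F i.
  have cH n : closed (H n : set X) by apply: closed_bigsetU.
  have mVH n : measurable (V `\` H n).
    by apply: measurableD; [apply: open_borel; exact: bigcup_open|exact: closed_borel].
  have [|||N mN] := @nonincreasing_measure_lt _ _ _ m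
    (fun n => V `\` H n) e%:E _ mVH.
  - exact: mfin.
  - move=> a b ab; apply/subsetPset; apply: setDS.
    exact: subset_bigsetU.
  - have mcap : measurable (\bigcap_n (V `\` H n)) by exact: bigcapT_measurable.
    apply: (@le_lt_trans _ _ (e / 2)%:E); last by rewrite lte_fin; lra.
    apply: (le_trans (@measure_sigma_subadditive _ _ _ m _ _ mUF mcap _)).
      move=> x capx; have [[i _ Ux] _] := capx 0%N I; exists i => //; split => //.
      move=> Fx; have [_ []] := capx i.+1 I.
      by rewrite /H big_ord_recr; right.
    apply: le_trans (epsilon_trick0 xpredT (_ : 0 <= e / 2)%R); last by lra.
    by apply: lee_nneseries => // i _; apply: ltW; have [] := FU i.
  (* A finite subunion is closed, and it misses little of the whole union. *)
  exists (H N), V; split => //.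
  + exact: bigcup_open.
  + move=> x; rewrite /H -bigcup_mkord => -[i _ Fx].
    by exists i => //; have [_ _ + _ _] := FU i; apply.
  + by apply: subset_bigcup => i _; have [] := FU i.
Qed.

Lemma borel_outer_regular (mu : {measure set (borel X) -> \bar R})
    (A : set (borel X)) (G : set X) (e : R) :
  open G -> mu G < +oo -> measurable A -> A `<=` G -> (0 < e)%R ->
  exists U : set X, [/\ open U, A `<=` U & mu (U `\` A) < e%:E].
Proof.
move=> oG muG mA AG e0; have mG := open_borel oG.
have [F [U [cF oU FA AU mUF]]] :=
  borel_closed_open_approx (mfrestr mG muG) mA e0.
exists (U `&` G); split; first exact: openI.
  by move=> x Ax; split; [exact: AU|exact: AG].
apply: le_lt_trans mUF; rewrite /mfrestr /mrestr/=.
have mU := open_borel oU; have mF := closed_borel cF.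
apply: le_measure; rewrite ?inE.
- by apply: measurableD => //; exact: measurableI.
- by apply: measurableI => //; exact: measurableD.
- by move=> x [[Ux Gx] Ax]; split => //; split => // /FA.
Qed.

End regularity.

(** * Concentration on a separable set *)

Section separability.
Context (R : realType) (X : pmetricType R).
Variable mu : {measure set (borel X) -> \bar R}.
Hypothesis mu_mm : metric_measure mu.

Lemma mball_finite k (x : X) s : mu (mball k x s) < +oo.
Proof.
have [_ h] := mu_mm; apply: h.
  exact: measurable_mball.
by exists x, s; exact: sub_mball_closed.
Qed.

(** By tau-additivity the finite measure of the ball of radius [s] is
    approached by finite subfamilies of its cover by balls of radius [e];
    countably many of them thus exhaust it up to a null set. *)
Lemma countable_ball_cover (x : X) (s e : R) : (0 < e)%R ->
  exists2 C : set X, countable C &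
    mu (mball OpenBalls x s `\` \bigcup_(c in C) mball OpenBalls c e) = 0.
Proof.
move=> e0; set G := mball OpenBalls x s.
pose B c := mball OpenBalls c e `&` G.
have oB c : open (B c) by apply: openI; exact: open_mball.
have mB c : measurable (B c : set (borel X)) by exact: open_borel.
have GE : \bigcup_(A in range B) A = G.
  apply/seteqP; split => [y [_ [c _ <-] []]//|y Gy].
  by exists (B y); [exists y|split => //; exact: mball_center].
have [tau _] := mu_mm.
have muG : mu G = ereal_sup [set mu (\bigcup_(A in F) A) | F in fsets (range B)].
  by rewrite -[in LHS]GE; apply: tau => _ [c _ <-]; exact: oB.
have Gfin : mu G \is a fin_num by rewrite ge0_fin_numE ?measure_ge0// mball_finite.
have FP n : exists F : set (set X), fsets (range B) F /\
    mu G - n.+1%:R^-1%:E < mu (\bigcup_(A in F) A).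
  have n0 : (0 < n.+1%:R^-1 :> R)%R by rewrite invr_gt0.
  move: Gfin; rewrite {1}muG => /(ub_ereal_sup_adherent n0)[_ [F FF <-]].
  by rewrite -muG => ?; exists F.
have /choice[F FF] := FP.
have /choice[g gP] : forall A : set X, exists c, (range B) A -> A = B c.
  move=> A; have [[c _ <-]|nA] := pselect (range B A); first by exists c.
  by exists point.
pose C := \bigcup_n g @` F n.
exists C.
  apply: bigcup_countable => // n _; apply: finite_set_countable.
  by apply: finite_image; have [[]] := FF n.
have mC : measurable (\bigcup_(c in C) mball OpenBalls c e : set (borel X)).
  by apply: open_borel; apply: bigcup_open => c _; exact: open_mball.
have mG : measurable (G : set (borel X)) by exact: measurable_mball.
have mF n : measurable (\bigcup_(A in F n) A : set (borel X)).
  apply: open_borel; apply: bigcup_open => A FA.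
  by have [[_ /(_ _ FA)[c _ <-]]] := FF n.
apply/eqP; rewrite -measure_le0; apply/lee_addgt0Pr => d d0; rewrite add0e.
have [n _ /(_ n (leqnn n)) nd] := near_infty_natSinv_lt (PosNum d0).
have sFC : \bigcup_(A in F n) A `<=` \bigcup_(c in C) mball OpenBalls c e.
  move=> y [A FA Ay]; exists (g A); first by exists n => //; exists A.
  have [[_ /(_ _ FA) /gP EA] _] := FF n.
  by move: Ay; rewrite {1}EA => -[].
have sFG : \bigcup_(A in F n) A `<=` G.
  by move=> y [A FA Ay]; have [[_ /(_ _ FA)[c _ EA]] _] := FF n;
    move: Ay; rewrite -EA => -[].
apply: (@le_trans _ _ (mu (G `\` \bigcup_(A in F n) A))).
  by apply: le_measure; rewrite ?inE; [exact: measurableD|exact: measurableD|exact: setDS].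
rewrite measureD// ?mball_finite// setIidr//.
have [_ /ltW] := FF n; rewrite leeBlDr// => FG.
rewrite leeBlDr; last first.
  rewrite ge0_fin_numE ?measure_ge0//.
  apply: le_lt_trans (mball_finite OpenBalls x s).
  by apply: le_measure; rewrite ?inE.
apply: (le_trans FG); rewrite addeC leeD2r// lee_fin; exact: ltW.
Qed.

(** The space itself need not be separable, but almost all of it is: take the
    centers of the countable covers for all radii [1 / (m + 1)]. A point outside
    the closure of these centers is missed by one of the covers. *)
Lemma separable_full_measure :
  exists q : nat -> X, mu (~` closure (range q)) = 0.
Proof.
have /choice[C CP] : forall nm : nat * nat, exists C : set X, countable C /\
    mu (mball OpenBalls point nm.1%:R `\`
        \bigcup_(c in C) mball OpenBalls c nm.2.+1%:R^-1) = 0.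
  move=> [n m]; have m0 : (0 < m.+1%:R^-1 :> R)%R by rewrite invr_gt0.
  by have [C ? ?] := countable_ball_cover point n%:R m0; exists C.
pose D := \bigcup_nm C nm.
have cD : countable D by apply: bigcup_countable => // nm _; have [] := CP nm.
have [q qD] : exists q : nat -> X, D `<=` range q.
  have [D0|[f]] := pfcard_geP cD; first by exists (fun=> point); rewrite D0.
  by exists f => y Dy; have [n _ <-] := @surj _ _ _ _ f y Dy; exists n.
exists q; apply/negligibleP.
  by apply: open_borel; rewrite openC; exact: closed_closure.
pose N n m : set (borel X) := mball OpenBalls point n%:R `\`
        \bigcup_(c in C (n, m)) mball OpenBalls c m.+1%:R^-1.
have mN n m : measurable (N n m).
  apply: measurableD; first exact: measurable_mball.
  by apply: open_borel; apply: bigcup_open => c _; exact: open_mball.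
apply: (negligibleS (A := \bigcup_n \bigcup_m N n m)); last first.
  apply: negligible_bigcup => n; apply: negligible_bigcup => m.
  by apply/negligibleP => //; have [] := CP (n, m).
move=> y /= qy; apply: contrapT => Ny; apply: qy => V /nbhs_ballP[d /= d0 dV].
have [m _ /(_ m (leqnn m)) md] := near_infty_natSinv_lt (PosNum d0).
pose n := Num.truncn (mdist point y).
have yn : mball OpenBalls point n.+1%:R y.
  by rewrite /=; exact: truncnS_gt.
have [c Cc cy] : (\bigcup_(c in C (n.+1, m)) mball OpenBalls c m.+1%:R^-1) y.
  by apply: contrapT => nC; apply: Ny; exists n.+1 => //; exists m.
have [i _ qi] : range q c by apply: qD; exists (n.+1, m).
exists c; split; first by exists i.
by apply: dV; rewrite ballEmdist /= metric_sym; exact: lt_trans cy md.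
Qed.

End separability.

Lemma nondecreasing_measure_le d (T : measurableType d) (R : realType)
    (m : {measure set T -> \bar R}) (F : (set T)^nat) (b : \bar R) :
  (forall i, measurable (F i)) -> nondecreasing_seq F ->
  (forall n, m (F n) <= b) -> m (\bigcup_n F n) <= b.
Proof.
move=> mF ndF Fb.
have cvF := nondecreasing_cvg_mu (mu := m) mF (bigcupT_measurable _ mF) ndF.
rewrite -(cvg_lim _ cvF)//; apply: lime_le; last exact: nearW.
by apply/cvg_ex; eexists; exact: cvF.
Qed.

(** The bound is on the sums over finite subsets of the index set, where each
    index counts once; an enumeration with repetitions then suffices, as the
    union of its first terms is indexed by a finite set. *)
Lemma countable_bigcup_measure_le d (T : measurableType d) (R : realType)
    (m : {measure set T -> \bar R}) (I : pointedType) (C : set I)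
    (B : I -> set T) (S : set T) (b : \bar R) :
  countable C -> (forall i, measurable (B i)) -> measurable S ->
  S `<=` \bigcup_(i in C) B i -> 0 <= b ->
  (forall F, finite_set F -> F `<=` C -> \sum_(i \in F) m (B i) <= b) ->
  m S <= b.
Proof.
move=> cC mB mS + b0 Fb; have [->|[f]] := pfcard_geP cC.
  by rewrite bigcup_set0 subset0 => ->; rewrite measure0.
pose H n := \bigcup_(k in `I_n) B (f k).
have mH n : measurable (H n) by exact: bigcup_measurable.
suff Hb : m (\bigcup_n H n) <= b; last first.
  apply: nondecreasing_measure_le => // [n k nk|n].
    by apply/subsetPset => y [i /= ni By]; exists i => //=; exact: leq_trans ni nk.
  apply: le_trans (Fb (f @` `I_n) _ _); last 2 first.
  - exact/finite_image/finite_II.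
  - by move=> _ [k _ <-]; exact: funS.
  apply: content_sub_fsum => //; first exact/finite_image/finite_II.
  by move=> y [k kn By]; exists (f k) => //; exists k.
move=> SC; apply: le_trans Hb; apply: le_measure; rewrite ?inE//.
  exact: bigcupT_measurable.
apply: subset_trans SC _ => y [i Ci Biy].
have [n _ fn] := @surj _ _ _ _ f i Ci.
by exists n.+1 => //; exists n => /=; rewrite ?ltnSn// fn.
Qed.

(** * Balls about separated points *)

Section ball_separated.
Context (R : realType) (X : pmetricType R).
Implicit Types (k : @ball_kind) (s : R) (S C : set X).

Definition ball_separated k s C :=
  forall c c', C c -> C c' -> c <> c' -> ~ mball k c s c'.

Lemma ball_separated_sub k s C C' :
  C' `<=` C -> ball_separated k s C -> ball_separated k s C'.
Proof. by move=> CC sC c c' /CC Cc /CC Cc'; exact: sC. Qed.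

(** Zorn: a point of [S] in no ball about a maximal separated subset could be
    added to it. *)
Lemma maximal_ball_separated k s S : (0 < s)%R ->
  exists C, [/\ C `<=` S, ball_separated k s C &
    S `<=` \bigcup_(c in C) mball k c s].
Proof.
move=> s0; pose P C := C `<=` S /\ ball_separated k s C.
have [F FP totF|C [[CS sC] maxC]] := @Zorn_bigcup X P.
  split; first by apply: bigcup_sub => C /FP[].
  move=> c c' [C FC Cc] [C' FC' Cc'].
  have [CC|CC] := totF _ _ FC FC'.
  - by have [_ h] := FP _ FC'; apply: h => //; exact: CC.
  - by have [_ h] := FP _ FC; apply: h => //; exact: CC.
exists C; split => // y Sy; apply: contrapT => nCy.
have nb c : C c -> ~ mball k c s y by move=> Cc cy; apply: nCy; exists c.
apply: (maxC (C `|` [set y])).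
  split; first by left.
  by move=> /(_ y (or_intror erefl)) /nb; apply; exact: mball_center.
split; first by move=> z [/CS//|->].
move=> c c' [Cc|->] [Cc'|->] //; [exact: sC|by move=> _; exact: nb|].
by move=> _; rewrite mball_sym; exact: nb.
Qed.

(** Sending each center to some [q n] at distance less than [s / 2] is
    injective, since two centers sharing their [q n] would be closer than [s]. *)
Lemma ball_separated_countable k s C (q : nat -> X) : (0 < s)%R ->
  C `<=` closure (range q) -> ball_separated k s C -> countable C.
Proof.
move=> s0 Cq sC.
have /choice[f fP] : forall c, exists n, C c -> (mdist c (q n) < s / 2)%R.
  move=> c; have [Cc|] := pselect (C c); last by exists 0%N.
  have [|_ [[n _ <-] cn]] := Cq _ Cc (mball OpenBalls c (s / 2)); last by exists n.
  apply/open_nbhs_nbhs; split; first exact: open_mball.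
  by apply: mball_center; rewrite divr_gt0.
apply/countable_injP; exists f => c c' /[!inE] Cc Cc' fcc.
apply: contrapT => /(sC _ _ Cc Cc'); apply; apply: sub_open_mball => /=.
have := metric_triangle c (q (f c)) c'; rewrite (metric_sym (q _)) {2}fcc.
have := fP _ Cc; have := fP _ Cc'; lra.
Qed.

(** Balls of one radius about separated points form a Besicovitch family, so
    that no point lies in more than [E(X, d)] of them. *)
Lemma ball_separated_overlap k s (C : set X) (y : X) : (0 < s)%R ->
  finite_set C -> ball_separated k s C ->
  \sum_(c \in C) (\1_(mball k c s) y : R)%:E <=
  equal_radius_besicovitch_constant X k.
Proof.
move=> s0 fC sC.
have injB : set_inj C (fun c => mball k c s).
  move=> c c' /[!inE] Cc Cc' Bcc; apply: contrapT => /(sC _ _ Cc Cc'); apply.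
  by rewrite Bcc; exact: mball_center.
rewrite (_ : \sum_(c \in C) _ =
    \esum_(B in (fun c => mball k c s) @` C) (\1_B y : R)%:E); last first.
  rewrite esum_fset//; last exact: finite_image.
  by rewrite [RHS](reindex_fsbig (fun c => mball k c s) C)//; exact: inj_bij.
apply: ereal_sup_ubound; exists y, ((fun c => mball k c s) @` C); split => //.
have /choice[g gP] : forall B : set X, exists c,
    ((fun c => mball k c s) @` C) B -> C c /\ B = mball k c s.
  move=> B; have [[c Cc <-]|] := pselect (((fun c => mball k c s) @` C) B).
    by exists c.
  by exists point.
exists g, (fun=> s); split; last by exists s.
split; first by move=> B /gP[].
move=> B1 B2 /gP[Cg1 E1] /gP[Cg2 E2] B12; rewrite E2; apply: sC => //.
by move=> g12; apply: B12; rewrite E1 E2 g12.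
Qed.

Lemma besicovitch_constant_ge1 k : 1 <= equal_radius_besicovitch_constant X k.
Proof.
apply: le_trans (@ball_separated_overlap k 1 [set point] point _ _ _) => //.
- by rewrite fsbig_set1 indicE mem_set//; exact: mball_center.
- by move=> c c' -> ->.
Qed.

(** Integrate the overlap bound over [W]. *)
Lemma sum_ball_measure_le k s (mu : {measure set (borel X) -> \bar R})
    (C : set X) (W : set (borel X)) : (0 < s)%R -> measurable W ->
  finite_set C -> ball_separated k s C ->
  \sum_(c \in C) mu (mball k c s `&` W) <=
  equal_radius_besicovitch_constant X k * mu W.
Proof.
move=> s0 mW fC sC; have mB c := @measurable_mball R X k c s.
rewrite (eq_fsbigr (fun c => \int[mu]_(y in W) (\1_(mball k c s) y)%:E)); last first.
  by move=> c _; rewrite integral_indic.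
rewrite -ge0_integral_fsum//; last first.
- by move=> c; apply/measurable_EFinP; exact: measurable_indic.
rewrite -integral_cst//; apply: ge0_le_integral => //.
- by move=> y _; apply: fsume_ge0 => c _; rewrite lee_fin.
- apply: emeasurable_fsum => // c; apply/measurable_EFinP.
  exact: measurable_indic.
- by move=> y _; exact: ball_separated_overlap.
Qed.

End ball_separated.

(** * From comparability on small balls to all Borel sets *)

Section domination.
Context (R : realType) (X : pmetricType R) (k : @ball_kind).
Variables (lam : {finite_measure set (borel X) -> \bar R})
  (mu : {measure set (borel X) -> \bar R}).
Hypothesis mu_mm : metric_measure mu.
Hypothesis E_fin : equal_radius_besicovitch_constant X k < +oo.

Local Notation E := (equal_radius_besicovitch_constant X k).

(** A finite union of null sets is null, and tau-additivity reaches the union of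
    all of them. *)
Lemma tau_null_open (V : set X) : tau_additive lam -> open V ->
  (forall x, V x -> exists B : set X, [/\ open B, B x & lam B = 0]) ->
  lam V = 0.
Proof.
move=> tau_lam oV VB.
pose U := [set A : set X | [/\ open A, A `<=` V & lam A = 0]].
have UE : \bigcup_(A in U) A = V.
  apply/seteqP; split => [y [A [_ AV _] /AV//]|y Vy].
  have [B [oB By B0]] := VB _ Vy.
  have mB := open_borel oB; have mV := open_borel oV.
  exists (B `&` V) => //; split => //; first exact: openI.
  by apply: (subset_measure0 _ mB _ B0) => //; exact: measurableI.
have oU A : U A -> open A by case.
rewrite -[X in lam X]UE tau_lam//; apply/eqP; rewrite eq_le; apply/andP; split.
  apply: ge_ereal_sup => _ [F [finF FU] <-].
  have mF A : F A -> measurable (A : set (borel X)).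
    by move=> /FU[oA _ _]; exact: open_borel.
  have mUF : measurable (\bigcup_(A in F) A : set (borel X)).
    by apply: open_borel; apply: bigcup_open => A /FU[].
  apply: le_trans (content_sub_fsum lam finF mF mUF _) _ => //.
  by rewrite fsbig1// => A /FU[].
apply: ereal_sup_ubound; exists set0; first exact: fsets_set0.
by rewrite bigcup_set0 measure0.
Qed.

(** Cover [S] by the balls about a maximal separated subset and sum: the parts
    of [W] that they contain overlap at most [E] times. *)
Lemma covering_estimate (s K : R) (q : nat -> X) (S W : set (borel X)) :
  (0 < s)%R -> (0 <= K)%R -> measurable S -> measurable W ->
  S `<=` closure (range q) ->
  (forall y, S y -> lam (mball k y s) <= K%:E * mu (mball k y s `&` W)) ->
  lam S <= K%:E * (E * mu W).
Proof.
move=> s0 K0 mS mW Sq Sball.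
have [C [CS sC SC]] := maximal_ball_separated k S s0.
have cC : countable C.
  by apply: ball_separated_countable s0 _ sC; exact: subset_trans Sq.
have mB c := @measurable_mball R X k c s.
have E0 : 0 <= E by apply: le_trans (besicovitch_constant_ge1 X k).
apply: countable_bigcup_measure_le cC mB mS SC _ _; first by rewrite !mule_ge0.
move=> F finF FC.
apply: (@le_trans _ _ (\sum_(c \in F) K%:E * mu (mball k c s `&` W))).
  by apply: lee_fsum => // c Fc; apply: Sball; apply/CS/FC.
rewrite -ge0_mule_fsumr; last by move=> c; exact: measure_ge0.
apply: lee_wpmul2l => //; apply: sum_ball_measure_le => //.
exact: ball_separated_sub sC.
Qed.

(** With [M < a], a ball centered in a set where [lam >= a * mu] cannot be mostly
    filled by that set, since this would push its [lam]-measure above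
    [M * mu]. Hence its [lam]-measure is paid for by the part of the ball that
    lies outside the set. *)
Lemma ball_deficit (M a : R) (A B : set (borel X)) :
  (0 <= M)%R -> (M < a)%R -> measurable A -> measurable B -> mu B < +oo ->
  lam B <= M%:E * mu B -> a%:E * mu (A `&` B) <= lam (A `&` B) ->
  lam B <= (M * a / (a - M))%:E * mu (B `\` A).
Proof.
move=> M0 Ma mA mB muB lamB lamA.
have mBA : measurable (B `\` A) by exact: measurableD.
have mAB : measurable (A `&` B) by exact: measurableI.
have fin (D : set (borel X)) : measurable D -> D `<=` B -> mu D \is a fin_num.
  move=> mD DB; rewrite ge0_fin_numE ?measure_ge0//; apply: le_lt_trans muB.
  by apply: le_measure; rewrite ?inE.
have lAB : lam (A `&` B) <= lam B by apply: le_measure; rewrite ?inE.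
have real (z : \bar R) : z \is a fin_num -> exists u, z = u%:E.
  by move=> zf; exists (fine z); rewrite fineK.
have [u uE] := real _ (fin _ mAB (@subIsetr _ _ _)).
have [v vE] := real _ (fin _ mBA (@subDsetl _ _ _)).
have [l lE] := real _ (fin_num_measure lam _ mB).
have muBE : mu B = (v + u)%:E.
  by rewrite EFinD -uE -vE setIC; exact: measureDI.
move: lamB (le_trans lamA lAB).
rewrite muBE lE uE vE -!EFinM !lee_fin => lM al.
rewrite [leRHS]mulrAC ler_pdivlMr ?subr_gt0//.
have a0 : (0 <= a)%R by lra.
have := ler_wpM2l a0 lM; have := ler_wpM2l M0 al.
nra.
Qed.

(** Choose an open [U] containing [A] with [mu (U `\` A)] small. A ball centered
    in [A] and contained in [U] has its [lam]-measure paid for by its part in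
    [U `\` A], so covering [A] by such balls bounds [lam A] by a constant
    multiple of [mu (U `\` A)]. This also disposes of the part of [lam] that
    is singular with respect to [mu]. *)
Lemma dominating_set_null (r M a : R) (q : nat -> X) (A G : set (borel X)) :
  (0 < r)%R -> (0 <= M)%R -> (M < a)%R ->
  (forall y s, (0 < s <= r)%R -> lam (mball k y s) <= M%:E * mu (mball k y s)) ->
  open (G : set X) -> mu G < +oo -> measurable A -> A `<=` G ->
  A `<=` closure (range q) ->
  (forall B : set (borel X), measurable B -> B `<=` A -> a%:E * mu B <= lam B) ->
  lam A = 0.
Proof.
move=> r0 M0 Ma lamB oG muG mA AG Aq lamA.
(* The equation is kept apart lest the constant be unfolded by rewriting. *)
have [K KE] : exists K, K = (M * a / (a - M))%R by eexists.
have K0 : (0 <= K)%R by rewrite KE !mulr_ge0 ?invr_ge0 ?subr_ge0//; lra.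
have E0 : 0 <= E by apply: le_trans (besicovitch_constant_ge1 X k).
have Efin : E \is a fin_num by rewrite ge0_fin_numE.
have est e : (0 < e)%R -> lam A <= (K * fine E * e)%:E.
  move=> e0; have [U [oU AU muUA]] := borel_outer_regular oG muG mA AG e0.
  have mU := open_borel oU; have mUA : measurable (U `\` A : set (borel X)).
    exact: measurableD.
  pose S n : set (borel X) := A `&` inner_core U n.+1%:R^-1.
  have mS n : measurable (S n).
    by apply: measurableI => //; apply: closed_borel; exact: closed_inner_core.
  rewrite (_ : A = \bigcup_n S n); last first.
    by rewrite -setI_bigcupr bigcup_inner_core// setIidl.
  apply: nondecreasing_measure_le => // [n m nm|n].
    by apply/subsetPset; apply: setIS; apply/subsetPset; exact: nondecreasing_inner_core.
  (* Any radius below the margin [n.+1%:R^-1] keeps the balls inside [U]. *)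
  pose s := Num.min r (n.+2%:R^-1)%R.
  have s0 : (0 < s)%R by rewrite lt_min r0 invr_gt0 ltr0n.
  have sr : (s <= r)%R by rewrite ge_min lexx.
  have sn : (s < n.+1%:R^-1)%R.
    by rewrite gt_min; apply/orP; right; rewrite ltf_pV2 ?posrE// ltr_nat.
  apply: (@le_trans _ _ (K%:E * (E * mu (U `\` A)))); last first.
    rewrite -mulrA EFinM; apply: lee_wpmul2l; first by rewrite lee_fin.
    by rewrite EFinM fineK//; apply: lee_wpmul2l => //; exact: ltW.
  apply: (covering_estimate s0 K0 (mS n) mUA).
    by move=> y [Ay _]; exact: Aq.
  move=> y [Ay Uy]; set B := mball k y s.
  have mB : measurable (B : set (borel X)) by exact: measurable_mball.
  have BU : B `<=` U by exact: mball_sub_core Uy sn.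
  rewrite (_ : B `&` (U `\` A) = B `\` A); last first.
    by rewrite setIDA setIidl.
  rewrite KE; apply: ball_deficit => //; first exact: mball_finite.
    by apply: lamB; rewrite s0.
  by apply: lamA; [exact: measurableI|exact: subIsetl].
apply/eqP; rewrite -measure_le0; apply/lee_addgt0Pr => d d0; rewrite add0e.
have KE0 : (0 <= K * fine E)%R by rewrite mulr_ge0// fine_ge0.
have e0 : (0 < d / (K * fine E + 1))%R by rewrite divr_gt0// ltr_wpDl.
apply: le_trans (est _ e0) _; rewrite lee_fin mulrA ler_pdivrMr ?ltr_wpDl//.
nra.
Qed.

Section ball_domination.
Variables (r M : R).
Hypotheses (r0 : (0 < r)%R) (M0 : (0 <= M)%R).
Hypothesis lamB : forall y s, (0 < s <= r)%R ->
  lam (mball k y s) <= M%:E * mu (mball k y s).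

Lemma ball_dominated_null_open (V : set X) : tau_additive lam ->
  open V -> mu V = 0 -> lam V = 0.
Proof.
move=> tau_lam oV V0; apply: tau_null_open => // x Vx.
have /nbhs_ballP[e /= e0 eV] : nbhs x V by apply: open_nbhs_nbhs; split.
pose s := Num.min r (e / 2)%R.
have s0 : (0 < s)%R by rewrite lt_min r0 divr_gt0.
have sr : (s <= r)%R by rewrite ge_min lexx.
have se : (s < e)%R by rewrite gt_min; apply/orP; right; lra.
exists (mball OpenBalls x s); split.
- exact: open_mball.
- exact: mball_center.
- apply/eqP; rewrite -measure_le0.
  have mB k' := @measurable_mball R X k' x s.
  apply: (@le_trans _ _ (lam (mball k x s))).
    by apply: le_measure; rewrite ?inE//; exact: sub_open_mball.
  apply: (le_trans (lamB _ _)); first by rewrite s0.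
  rewrite (_ : mu _ = 0) ?mule0//.
  apply: (subset_measure0 _ (open_borel oV)) => // y xy; apply: eV.
  by rewrite ballEmdist /=; apply: le_lt_trans se; exact: sub_mball_closed xy.
Qed.

(** Split [A] along a Hahn decomposition of [lam - a * mu]: the negative part
    satisfies the inequality, the positive part is [lam]-null. *)
Lemma bounded_domination (q : nat -> X) (a : R) (A G : set (borel X)) :
  lam (~` closure (range q)) = 0 -> (M < a)%R ->
  open (G : set X) -> mu G < +oo -> measurable A -> A `<=` G ->
  lam A <= a%:E * mu A.
Proof.
move=> lamq Ma oG muG mA AG; have mG := open_borel oG.
have a0 : (0 <= a)%R by apply: le_trans M0 (ltW Ma).
pose sigma := cadd (charge_of_finite_measure lam)
  (cscale (- a) (charge_of_finite_measure (mfrestr mG muG))).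
have sigmaE (B : set (borel X)) : B `<=` G -> sigma B = lam B - a%:E * mu B.
  move=> BG; transitivity (lam B + (- a)%:E * mu (B `&` G)); first by [].
  by rewrite setIidl// EFinN mulNe.
have [P [N [[mP posP] [mN negN] PN _]]] := Hahn_decomposition sigma.
have muf (B : set (borel X)) : measurable B -> B `<=` A -> a%:E * mu B \is a fin_num.
  move=> mB BA; rewrite fin_numM// ge0_fin_numE ?measure_ge0//.
  apply: (le_lt_trans _ muG); apply: le_measure; rewrite ?inE//.
  exact: subset_trans AG.
have mcl : measurable (closure (range q) : set (borel X)).
  by apply: closed_borel; exact: closed_closure.
have mAP := measurableI _ _ mA mP.
have mAN := measurableI _ _ mA mN.
have AP0 : lam (A `&` P `&` closure (range q)) = 0.
  apply: (dominating_set_null r0 M0 Ma lamB oG muG (q := q)).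
  - exact: measurableI.
  - by move=> y [[/AG]].
  - by move=> y [].
  - move=> B mB BAPq.
    have BA : B `<=` A by move=> y /BAPq[[]].
    rewrite -sube_ge0 ?muf// -sigmaE; last exact: subset_trans AG.
    by apply: posP => // y /BAPq[[]].
have APC0 : lam (A `&` P `&` ~` closure (range q)) = 0.
  apply: (subset_measure0 _ (measurableC mcl)) => //.
  by apply: measurableI => //; exact: measurableC.
have lamAP : lam (A `&` P) = 0.
  transitivity (lam (A `&` P `&` ~` closure (range q)) +
    lam (A `&` P `&` closure (range q))); first exact: measureDI.
  by rewrite AP0 APC0 adde0.
have lamAN : lam (A `&` N) <= a%:E * mu (A `&` N).
  have fAN := muf _ mAN (@subIsetl _ _ _); rewrite -sube_le0//.
  by rewrite -sigmaE; [apply: negN => // y []|move=> y [/AG]].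
have -> : lam A = lam (A `&` P `|` A `&` N) by rewrite -setIUr PN setIT.
apply: (@le_trans _ _ (lam (A `&` P) + lam (A `&` N))); first exact: measureU2.
rewrite lamAP add0e.
apply: (le_trans lamAN); apply: lee_wpmul2l; first by rewrite lee_fin.
by apply: le_measure; rewrite ?inE//; exact: subIsetl.
Qed.

(** Summing over a cover alone would lose the factor [E]; the constant is
    preserved because every multiple [a > M] works on bounded sets; these have
    finite [mu]-measure, so that [a] may tend to [M]. *)
Lemma ball_domination (A : set (borel X)) : tau_additive lam ->
  measurable A -> lam A <= M%:E * mu A.
Proof.
move=> tau_lam mA.
have [q muq] := separable_full_measure mu_mm.
have lamq : lam (~` closure (range q)) = 0.
  by apply: ball_dominated_null_open => //; apply: closed_openC; exact: closed_closure.
pose G n := mball OpenBalls (@point X) n%:R.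
have mG n : measurable (G n : set (borel X)) by exact: measurable_mball.
have mAG n := measurableI _ _ mA (mG n).
have AE : A = \bigcup_n (A `&` G n).
  rewrite -setI_bigcupr (_ : \bigcup_n G n = setT) ?setIT//.
  apply/seteqP; split => // y _; exists (Num.truncn (mdist point y)).+1 => //=.
  exact: truncnS_gt.
rewrite [X in lam X]AE; apply: nondecreasing_measure_le => // [n m nm|n].
  by apply/subsetPset; apply: setIS => y /= /lt_le_trans; apply; rewrite ler_nat.
apply: (@le_trans _ _ (M%:E * mu (A `&` G n))); last first.
  by apply: lee_wpmul2l; rewrite ?lee_fin//; apply: le_measure; rewrite ?inE//;
    exact: subIsetl.
have mufin : mu (A `&` G n) \is a fin_num.
  rewrite ge0_fin_numE ?measure_ge0//.
  apply: le_lt_trans (mball_finite mu_mm OpenBalls point n%:R).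
  by apply: le_measure; rewrite ?inE; [exact: mAG|exact: mG|exact: subIsetr].
apply/lee_addgt0Pr => d d0.
pose u := fine (mu (A `&` G n)).
have u0 : (0 <= u)%R by rewrite fine_ge0.
have du : (0 < d / (u + 1))%R by rewrite divr_gt0// ltr_wpDl.
have Ma : (M < M + d / (u + 1))%R by rewrite ltrDl.
(* The excess of the multiple over [M] costs at most [d], as [u < u + 1]. *)
apply: le_trans (bounded_domination lamq Ma _ _ _ (@subIsetr _ _ _)) _ => //.
- exact: open_mball.
- exact: mball_finite.
rewrite -(fineK mufin) -/u -!EFinM -EFinD lee_fin mulrDl lerD2l.
by rewrite mulrAC ler_pdivrMr ?ltr_wpDl//; nra.
Qed.

End ball_domination.

End domination.

(** * Modifications on null sets, and the completion *)

Section null_modification.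
Context d (T : measurableType d) (R : realType).
Variable mu : {measure set T -> \bar R}.

Import HBNNSimple.

(** No measurability is assumed, the integral being then the supremum over the
    simple functions below: a simple function may be cut off on a null set
    without changing its integral. *)
Lemma ge0_le_integral_off_null (D N : set T) (f1 f2 : T -> \bar R) :
  measurable N -> mu N = 0 ->
  (forall x, D x -> 0 <= f1 x) -> (forall x, D x -> 0 <= f2 x) ->
  (forall x, D x -> ~ N x -> f1 x <= f2 x) ->
  \int[mu]_(x in D) f1 x <= \int[mu]_(x in D) f2 x.
Proof.
move=> mN N0 f10 f20 f12; rewrite !ge0_integralE//=.
apply: ge_ereal_sup => _ [h /= hf <-].
apply: ereal_sup_ubound; exists (proj_nnsfun h (measurableC mN)) => /=.
  move=> x; rewrite mindicE; case: (boolP (x \in ~` N)) => [|_]; last first.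
    rewrite mulr0 patchE; case: ifPn => // /set_mem; exact: f20.
  rewrite inE mulr1 => /= Nx; apply: (le_trans (hf x)); rewrite !patchE.
  by case: ifPn => // /set_mem Dx; exact: f12.
rewrite -!integralT_nnsfun; apply: ge0_ae_eq_integral => //.
- exact/measurable_EFinP.
- exact/measurable_EFinP.
- by move=> x _; rewrite lee_fin.
- by move=> x _; rewrite lee_fin.
exists N; split => // x /=; apply: contra_notP => Nx _.
by rewrite mindicE mem_set//= mulr1.
Qed.

Lemma eq_integral_off_null (D N : set T) (f1 f2 : T -> \bar R) :
  measurable N -> mu N = 0 -> (forall x, ~ N x -> f1 x = f2 x) ->
  \int[mu]_(x in D) f1 x = \int[mu]_(x in D) f2 x.
Proof.
move=> mN N0 f12; rewrite integralE [RHS]integralE.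
by congr (_ - _); apply/eqP; rewrite eq_le; apply/andP; split;
  apply: (ge0_le_integral_off_null mN N0) => // x _ /f12 f12x;
  by rewrite ?funeposE ?funenegE f12x.
Qed.

Lemma eq_Lnorm_off_null (p : \bar R) (N : set T) (f1 f2 : T -> \bar R) :
  measurable N -> mu N = 0 -> (forall x, ~ N x -> f1 x = f2 x) ->
  -oo < p -> 'N[mu]_p[f1] = 'N[mu]_p[f2].
Proof.
move=> mN N0 f12; rewrite unlock /Lnorm; case: p => [p _|_|//].
  by congr (_ `^ _); apply: eq_integral_off_null mN N0 _ => x /f12 ->.
case: ifPn => // _; apply: eq_ess_sup; exists N; split => // x /=.
by apply: contra_notP => /f12 ->.
Qed.

End null_modification.

(** The preimages of the rays with rational endpoints are Borel up to null sets;
    off the countable union of these null sets [g] is Borel. *)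
Lemma completion_measurable_borel (R : realType) (X : pmetricType R)
    (mu : {measure set (borel X) -> \bar R}) (g : X -> R) :
  completion_measurable mu g ->
  exists (h : borel X -> R) (N : set (borel X)),
    [/\ measurable_fun [set: borel X] h, measurable N, mu N = 0 &
        forall x, ~ N x -> g x = h x].
Proof.
move=> mg.
have /choice[A /choice[N AN]] : forall q : rat, exists A N : set (borel X),
    [/\ measurable A, measurable N, mu N = 0,
        A `<=` g @^-1` `]ratr q, +oo[%classic &
        g @^-1` `]ratr q, +oo[%classic `<=` A `|` N].
  move=> q; have [A mA [N0 [N [mN N0' N0N]] AE]] :=
    mg _ (measurable_itv `]ratr q, +oo[).
  by exists A, N; split => //; rewrite -AE; [left|exact: setUS].
pose NN := \bigcup_q N q.
have mNN : measurable (NN : set (borel X)).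
  by apply: bigcupT_measurable_rat => q; have [] := AN q.
have mC := measurableC mNN.
exists (g \_ (~` NN)), NN; split => //; last first.
- by move=> x Nx; rewrite patchE mem_set.
- apply/negligibleP => //.
  apply: (negligibleS (A := \bigcup_n if @unpickle rat n is Some q
    then N q else set0)).
    by move=> x [q _ Nx]; exists (pickle q); rewrite ?pickleK.
  apply: negligible_bigcup => n; case: unpickle => [q|]; last exact: negligible_set0.
  by apply/negligibleP; have [] := AN q.
apply/(measurable_restrictT _ mC) => _.
apply: (measurability _ (RGenOInfty.measurableE R)) => //.
move=> /= _ [_ [a ->] <-].
rewrite (_ : _ `&` _ = ~` NN `&`
    \bigcup_(q : rat) if (a < ratr q)%R then A q else set0); last first.
  apply/seteqP; split => x [NNx]; rewrite preimage_itvoy.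
    move=> /= agx; split => //.
    have [q] := rat_in_itvoo agx; rewrite in_itv /= => /andP[aq qg].
    exists q => //; rewrite aq; have [_ _ _ _ /(_ x)] := AN q.
    rewrite preimage_itvoy => /(_ qg)[//|Nx].
    by case: NNx; exists q.
  move=> [q _]; case: ifPn => // aq Aq; split => //=.
  have [_ _ _ /(_ x Aq)] := AN q; rewrite preimage_itvoy /= => qg _.
  exact: lt_trans aq qg.
apply: measurableI => //; apply: bigcupT_measurable_rat => q.
by case: ifPn => // _; have [] := AN q.
Qed.

(** * Integration against a charge *)

Section charge_integral.
Context (R : realType) (X : pmetricType R).
Implicit Types nu : {charge set (borel X) -> \bar R}.

Lemma charge_total_variation_concentrated nu (B A : set (borel X)) :
  measurable B -> measurable A ->
  (forall A, measurable A -> nu A = nu (A `&` B)) ->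
  charge_total_variation nu A = charge_total_variation nu (A `&` B).
Proof.
move=> mB mA nuB; rewrite /charge_total_variation /charge_variation.
have mAB := measurableI _ _ mA mB.
have [[mP _] [mN _] _ _] := hahn_posneg nu.
rewrite /= !jordan_posE !jordan_negE !cjordan_posE !cjordan_negE.
rewrite /crestr0/= !mem_set// /crestr.
rewrite [in LHS]nuB; last exact: measurableI.
rewrite [X in _ - X = _]nuB; last exact: measurableI.
by rewrite setIAC; congr (_ - nu _); rewrite setIAC.
Qed.

Lemma charge_integral_le nu (mu : {measure set (borel X) -> \bar R})
    (B : set (borel X)) (a : R) (g : borel X -> R) :
  (0 <= a)%R -> measurable B -> measurable_fun [set: borel X] g ->
  (forall A, measurable A -> charge_total_variation nu A <= a%:E * mu A) ->
  `|charge_integral nu B g| <= a%:E * \int[mu]_(y in B) `|(g y)%:E|.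
Proof.
move=> a0 mB mg nua; rewrite /charge_integral.
have mgE : measurable_fun B (EFin \o g).
  by apply: measurable_funTS; exact/measurable_EFinP.
have mgA : measurable_fun [set: borel X] (fun y => `|(g y)%:E|).
  by apply: measurableT_comp => //; exact/measurable_EFinP.
apply: (le_trans (lee_abs_sub _ _)).
apply: (@le_trans _ _ (\int[measure_add (pos_part nu) (neg_part nu)]_(y in B) `|(g y)%:E|)).
  rewrite ge0_integral_measure_add//; last exact: measurable_funTS.
  by apply: leeD; apply: le_abse_integral.
rewrite -(@ge0_integral_mscale _ _ _ mu B mB (NngNum a0))//; last exact: measurable_funTS.
apply: ge0_le_measure_integral => // A mA; apply: (le_trans _ (nua A mA)).
by rewrite [leLHS](measure_addE (pos_part nu) (neg_part nu) A).
Qed.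

End charge_integral.

(** * Averages over balls *)

Section ball_kernel.
Context (R : realType) (X : pmetricType R) (q : nat -> X).

(** The product Borel sets need not contain the strip [d (x, y) < t] when [X] is
    not separable. This countable union of rectangles is contained in the strip
    and has the same sections over the closure of the points [q n]. *)
Definition open_ball_kernel (t : R) : set (borel X * borel X) :=
  \bigcup_n \bigcup_(p : rat)
    (mball OpenBalls (q n) (ratr p) `*` mball OpenBalls (q n) (t - ratr p)).

Definition ball_kernel k (t : R) : set (borel X * borel X) :=
  match k with
  | OpenBalls => open_ball_kernel t
  | ClosedBalls => \bigcap_m open_ball_kernel (t + m.+1%:R^-1)
  end.

Lemma measurable_ball_kernel k t : measurable (ball_kernel k t).
Proof.
have mo s : measurable (open_ball_kernel s).
  apply: bigcupT_measurable => n; apply: bigcupT_measurable_rat => p.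
  by apply: measurableX; exact: measurable_mball.
by case: k => //=; exact: bigcapT_measurable.
Qed.

Lemma open_ball_kernel_sub t x y :
  open_ball_kernel t (x, y) -> (mdist x y < t)%R.
Proof.
move=> [n _ [p _ [/= qx qy]]]; have := metric_triangle x (q n) y.
rewrite (metric_sym x (q n)); lra.
Qed.

Lemma open_ball_kernel_section t x y : closure (range q) x ->
  (mdist x y < t)%R -> open_ball_kernel t (x, y).
Proof.
move=> qx xyt; pose e := ((t - mdist x y) / 2)%R.
have e0 : (0 < e)%R by rewrite divr_gt0 ?subr_gt0.
have [|_ [[n _ <-] /= xn]] := qx (mball OpenBalls x e).
  by apply: open_nbhs_nbhs; split; [exact: open_mball|exact: mball_center].
have nx := metric_sym x (q n).
have [|p] := @rat_in_itvoo R (mdist (q n) x) (t - mdist x y - mdist (q n) x)%R.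
  by move: xn; rewrite nx /e; lra.
rewrite in_itv /= => /andP[np pt].
exists n => //; exists p => //; split => //=.
have := metric_triangle (q n) x y; lra.
Qed.

Lemma ball_kernel_sub k t x y : ball_kernel k t (x, y) -> mball k x t y.
Proof.
case: k => /=; first exact: open_ball_kernel_sub.
move=> Kxy; apply/ler_addgt0Pr => d d0.
have [n _ /(_ n (leqnn n)) nd] := near_infty_natSinv_lt (PosNum d0).
apply: le_trans (ltW (open_ball_kernel_sub (Kxy n I))) _.
by rewrite lerD2l; exact: ltW.
Qed.

Lemma ball_kernel_section k t x y : closure (range q) x ->
  mball k x t y -> ball_kernel k t (x, y).
Proof.
move=> qx; case: k => /=; first exact: open_ball_kernel_section.
move=> xy n _; apply: open_ball_kernel_section => //.
by apply: le_lt_trans xy _; rewrite ltrDl invr_gt0.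
Qed.

End ball_kernel.

(** A name for [mu] that can carry the structure of sigma-finite measure given
    by a hypothesis. *)
Definition sigma_finite_copy d (T : measurableType d) (R : realType)
  (mu : {measure set T -> \bar R}) & sigma_finite [set: T] mu :
  set T -> \bar R := mu.

Section sigma_finite_copy.
Context d (T : measurableType d) (R : realType).
Variables (mu : {measure set T -> \bar R}) (smu : sigma_finite [set: T] mu).

HB.instance Definition _ := Measure.on (sigma_finite_copy smu).

HB.instance Definition _ :=
  @Measure_isSigmaFinite.Build _ _ _ (sigma_finite_copy smu) smu.

End sigma_finite_copy.

Section tonelli.
Context (R : realType) (X : pmetricType R) (k : @ball_kind).
Variable mu : {measure set (borel X) -> \bar R}.
Hypothesis mu_mm : metric_measure mu.

Lemma metric_measure_sigma_finite : sigma_finite [set: borel X] mu.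
Proof.
exists (fun n => mball OpenBalls point n%:R).
  apply/esym/seteqP; split => // y _; exists (Num.truncn (mdist point y)).+1 => //=.
  exact: truncnS_gt.
by move=> n; split; [exact: measurable_mball|exact: mball_finite].
Qed.

(** Exchange the integrations: each value of [f] is counted with the measure of
    a ball of radius [r]. The function [h] agrees almost everywhere with the
    integral over the ball, and is measurable by Tonelli's theorem. *)
Lemma integral_ball_average_le (r : R) (f : borel X -> \bar R) :
  measurable_fun [set: borel X] f -> (forall y, 0 <= f y) ->
  exists h : borel X -> \bar R,
    [/\ measurable_fun [set: borel X] h,
        forall x, \int[mu]_(y in mball k x r) f y <= h x &
        \int[mu]_x h x <= sup_ball_measure k r mu * \int[mu]_y f y].
Proof.
move=> mf f0.
have [q muq] := separable_full_measure mu_mm.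
pose C : set (borel X) := closure (range q).
have mC : measurable C by apply: closed_borel; exact: closed_closure.
pose m := sigma_finite_copy metric_measure_sigma_finite.
pose K := ball_kernel q k r.
have mK : measurable K by exact: measurable_ball_kernel.
pose F (z : borel X * borel X) := (\1_K z)%:E * f z.2.
have F0 z : 0 <= F z by rewrite mule_ge0// lee_fin.
have mF : measurable_fun [set: borel X * borel X] F.
  apply: emeasurable_funM.
    by apply/measurable_EFinP; exact: measurable_indic.
  by apply: (measurableT_comp mf); exact: measurable_snd.
pose I x := \int[mu]_y F (x, y).
have mI : measurable_fun [set: borel X] I.
  exact: (measurable_fun_fubini_tonelli_F (m2 := m) F).
have I0 x : 0 <= I x by exact: integral_ge0.
(* Infinite on the null set where the sections of the kernel are not balls. *)
pose Z x := +oo * (\1_(~` C) x : R)%:E.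
have Z0 x : 0 <= Z x by rewrite mule_ge0// ?lee_fin.
have mZ0 : measurable_fun [set: borel X] (fun x => (\1_(~` C) x : R)%:E).
  by apply/measurable_EFinP; apply: measurable_indic; exact: measurableC.
have mZ : measurable_fun [set: borel X] Z by exact: measurable_funeM.
exists (fun x => I x + Z x); split.
- exact: emeasurable_funD.
- move=> x; have [Cx|Cx] := pselect (C x); last first.
    by rewrite /Z indicE mem_set//= mule1 addey ?leey// gt_eqF// (lt_le_trans _ (I0 x)).
  apply: le_trans (leeDl _ (Z0 x)); rewrite /I.
  rewrite integral_mkcond; apply: ge0_le_integral => //.
  + by move=> y _; rewrite patchE; case: ifP.
  + apply/(measurable_restrictT _ (measurable_mball k x r)).
    exact: measurable_funTS.
  + by apply: (measurableT_comp mF); exact: measurable_pair1.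
  + move=> y _; rewrite patchE; case: ifPn => // /set_mem xy.
    by rewrite /F indicE mem_set ?mul1e//; exact: ball_kernel_section.
rewrite ge0_integralD// [X in _ + X]ge0_integralZl//.
rewrite integral_indic//; last exact: measurableC.
rewrite setIT muq mule0 adde0 /I.
rewrite (_ : \int[mu]_x \int[mu]_y F (x, y) = \int[mu]_y \int[mu]_x F (x, y)); last first.
  exact: (fubini_tonelli (m1 := m) (m2 := m)).
rewrite -ge0_integralZl//; last first.
  apply: (le_trans (measure_ge0 mu (mball k point r))).
  by apply: ereal_sup_ubound; exists point.
apply: ge0_le_integral => //.
- by move=> y _; exact: integral_ge0.
- exact: (measurable_fun_fubini_tonelli_G (m1 := m) F).
- exact: measurable_funeM.
move=> y _.
apply: (@le_trans _ _ (\int[mu]_x (f y * (\1_(mball k y r) x : R)%:E))).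
  apply: ge0_le_integral => //.
  - by apply: (measurableT_comp mF); exact: measurable_pair2.
  - apply: measurable_funeM; apply/measurable_EFinP; apply: measurable_indic.
    exact: measurable_mball.
  - move=> x _; rewrite /F/= muleC; apply: lee_wpmul2l => //.
    rewrite lee_fin !indicE; case: (boolP (_ \in K)) => // /set_mem/ball_kernel_sub.
    by rewrite mball_sym => yx; rewrite mem_set.
rewrite ge0_integralZl//.
- rewrite integral_indic//; last exact: measurable_mball.
  rewrite setIT muleC; apply: lee_wpmul2r => //.
  by apply: ereal_sup_ubound; exists y.
- apply/measurable_EFinP; apply: measurable_indic; exact: measurable_mball.
Qed.

End tonelli.

(** Hoelder's inequality on [B], with the constant function 1. *)
Lemma power_mean_le d (T : measurableType d) (R : realType)
    (mu : {measure set T -> \bar R}) (B : set T) (g : T -> R) (p : R) :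
  measurable B -> measurable_fun [set: T] g -> (1 <= p)%R ->
  (\int[mu]_(y in B) `|(g y)%:E|) `^ p <=
  mu B `^ (p - 1) * \int[mu]_(y in B) (`|(g y)%:E| `^ p).
Proof.
move=> mB mg p1.
have int0 : 0 <= \int[mu]_(y in B) `|(g y)%:E| by exact: integral_ge0.
have [<-|p1'] := eqVneq 1%R p.
  rewrite subrr poweRe0 mul1e poweRe1//.
  by under [leRHS]eq_integral do rewrite poweRe1//.
have {p1 p1'}p1 : (1 < p)%R by rewrite lt_neqAle p1'.
have p0 : (0 < p)%R by lra.
pose q := (p / (p - 1))%R.
have q0 : (0 < q)%R by rewrite divr_gt0// subr_gt0.
have pq : (q^-1 + p^-1 = 1)%R.
  by rewrite /q invf_div -[X in (_ + X)%R]mul1r -mulrDl subrK divff// gt_eqF.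
have mB1 : measurable_fun [set: T] (\1_B : T -> R) by exact: measurable_indic.
have mgB : measurable_fun [set: T] (g \* (\1_B : T -> R))%R by exact: measurable_funM.
have := hoelder mu mB1 mgB q0 p0 pq.
have -> : 'N[mu]_1[EFin \o (\1_B \* (g \* (\1_B : T -> R)))%R] =
    \int[mu]_(y in B) `|(g y)%:E|.
  rewrite Lnorm1 [RHS]integral_mkcond; apply: eq_integral => y _.
  rewrite patchE /= indicE; case: (y \in B) => /=.
    by rewrite mul1r mulr1.
  by rewrite mul0r normr0.
have -> : 'N[mu]_q%:E[EFin \o (\1_B : T -> R)] = mu B `^ q^-1.
  rewrite unlock; congr (_ `^ _).
  rewrite (eq_integral (fun y => (\1_B y : R)%:E)); last first.
    move=> y _; rewrite /= indicE; case: (y \in B) => /=.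
      by rewrite normr1 powR1.
    by rewrite normr0 powR0// gt_eqF.
  by rewrite integral_indic// setIT.
have -> : 'N[mu]_p%:E[EFin \o (g \* (\1_B : T -> R))%R] =
    (\int[mu]_(y in B) (`|(g y)%:E| `^ p)) `^ p^-1.
  rewrite unlock; congr (_ `^ _); rewrite [RHS]integral_mkcond.
  apply: eq_integral => y _; rewrite patchE /= indicE; case: (y \in B) => /=.
    by rewrite mulr1.
  by rewrite mulr0 normr0 powR0// gt_eqF.
move=> H; have P0 : 0 <= \int[mu]_(y in B) (`|(g y)%:E| `^ p).
  by apply: integral_ge0 => y _; exact: poweR_ge0.
have := gt0_ler_poweR (ltW p0) _ _ H.
rewrite poweRM ?poweR_ge0// -!poweRrM mulVf ?gt_eqF// (poweRe1 P0).
rewrite (_ : (q^-1 * p = p - 1)%R); last by rewrite /q invf_div divfK// gt_eqF.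
by apply; rewrite in_itv /= ?leey ?andbT// mule_ge0// poweR_ge0.
Qed.

(** * Convolution with an adapted filter *)

Section charge_variation_finite.
Context d (T : measurableType d) (R : realType).
Variable nu : {charge set T -> \bar R}.
Variables (P N : set T) (nuPN : hahn_decomposition nu P N).

Let charge_variation_fin : fin_num_fun (charge_variation nuPN).
Proof. by move=> A mA; exact: fin_num_measure. Qed.

HB.instance Definition _ := @Measure_isFinite.Build _ _ _
  (charge_variation nuPN) charge_variation_fin.

End charge_variation_finite.

Section upper_norms.
Context (R : realType) (X : pmetricType R).
Variable mu : {measure set (borel X) -> \bar R}.

Lemma upper_integral_le (f h : borel X -> \bar R) :
  measurable_fun [set: borel X] h -> (forall x, 0 <= f x) ->
  (forall x, f x <= h x) -> upper_integral mu f <= \int[mu]_x h x.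
Proof.
move=> mh f0 fh; apply: ereal_inf_lbound; exists h => //=; split => // x.
by split => //; exact: le_trans (f0 x) (fh x).
Qed.

Lemma upper_Loo_norm_le (f : X -> \bar R) (b : \bar R) :
  0 <= b -> (forall x, `|f x| <= b) -> upper_Loo_norm mu f <= b.
Proof.
case: b => [b|_ _|//]; last exact: leey.
rewrite lee_fin => b0 fb; apply: ereal_inf_lbound; exists b => //=; split => //.
rewrite (_ : [set _ | _] = set0); first exact: negligible_set0.
by rewrite -subset0 => x /=; rewrite ltNge fb.
Qed.

Lemma integral_le_Loo_norm (B : set (borel X)) (h : borel X -> R) :
  measurable B -> measurable_fun [set: borel X] h ->
  \int[mu]_(y in B) `|(h y)%:E| <= mu B * 'N[mu]_(+oo)[EFin \o h].
Proof.
move=> mB mh.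
have mhE : measurable_fun B (fun y => `|(h y)%:E|).
  by apply: measurable_funTS; apply: measurableT_comp => //; exact/measurable_EFinP.
rewrite unlock /Lnorm; case: ifPn => [muT|]; last first.
  rewrite -leNgt => muT; rewrite mule0.
  rewrite (@eq_integral_off_null _ _ _ mu B setT _ (cst 0)) ?integral0//.
    by apply/eqP; rewrite -measure_le0.
  by move=> x /(_ I).
rewrite muleC -integral_cst//; apply: ae_ge0_le_integral => //.
  by move=> y _; apply: ess_sup_gee => //; apply: nearW => z; exact: abse_ge0.
by apply: filterS (ess_sup_ge mu (abse \o (EFin \o h))) => y hy _.
Qed.

End upper_norms.

Section filter_convolution.
Context (R : realType) (X : pmetricType R) (k : @ball_kind) (r : R).
Variables (mu : {measure set (borel X) -> \bar R})
  (nu : X -> {charge set (borel X) -> \bar R}) (M : R).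
Hypotheses (r_gt0 : (0 < r)%R) (mu_mm : metric_measure mu)
  (E_fin : equal_radius_besicovitch_constant X k < +oo)
  (nu_filter : signed_ball_filter k r nu) (nu_adapted : adapted k r mu nu M).

Local Notation S := (sup_ball_measure k r mu).

Lemma ball_measure_le_sup x : mu (mball k x r) <= S.
Proof. by apply: ereal_sup_ubound; exists x. Qed.

Lemma sup_ball_measure_ge0 : 0 <= S.
Proof. exact: le_trans (ball_measure_le_sup point). Qed.

(** A negative constant is possible only when all these balls are null. *)
Lemma mule_sup_ball_measure : M%:E * S = (Num.max M 0)%:E * S.
Proof.
have [//|M0] := leP 0%R M.
suff -> : S = 0 by rewrite !mule0.
apply/eqP; rewrite eq_le sup_ball_measure_ge0 andbT.
apply: ge_ereal_sup => _ [x _ <-].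
have rr : (0 < r <= r)%R by rewrite r_gt0 lexx.
have := nu_adapted x x rr; rewrite setIid => H; rewrite leNgt; apply/negP => B0.
have : 0 <= M%:E * mu (mball k x r) by apply: le_trans H.
by rewrite leNgt nmule_rlt0 ?lte_fin// B0.
Qed.

(** As [nu x] lives on its ball, the intersection with that ball in the
    definition of an adapted filter may be dropped, and the comparison with
    [mu] holds on small balls of the whole space. *)
Lemma filter_domination x (A : set (borel X)) : measurable A ->
  charge_total_variation (nu x) A <= (Num.max M 0)%:E * mu A.
Proof.
have [nu_conc tau] := nu_filter x.
have mB y s := @measurable_mball R X k y s.
have M0 : (0 <= Num.max M 0)%R by rewrite le_max lexx orbT.
pose lam : {finite_measure set (borel X) -> \bar R} :=
  charge_variation (hahn_posneg (nu x)).
have lamB y s : (0 < s <= r)%R ->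
    lam (mball k y s) <= (Num.max M 0)%:E * mu (mball k y s).
  move=> sr.
  apply: (@le_trans _ _ ((Num.max M 0)%:E * mu (mball k y s `&` mball k x r))).
    rewrite [leLHS](charge_total_variation_concentrated (mB x r) (mB y s) nu_conc).
    apply: (le_trans (nu_adapted x y sr)); apply: lee_wpmul2r => //.
    by rewrite lee_fin le_max lexx.
  apply: lee_wpmul2l => //; apply: le_measure; rewrite ?inE.
  - exact: measurableI.
  - exact: mB.
  - exact: subIsetl.
exact: (ball_domination mu_mm E_fin r_gt0 M0 lamB tau).
Qed.

Lemma convolution_le (g : borel X -> R) x : measurable_fun [set: borel X] g ->
  `|convolution k r nu g x| <=
  (Num.max M 0)%:E * \int[mu]_(y in mball k x r) `|(g y)%:E|.
Proof.
move=> mg; apply: charge_integral_le => //; first by rewrite le_max lexx orbT.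
  exact: measurable_mball.
exact: filter_domination.
Qed.

Lemma convolution_off_null (g h : X -> R) (N : set (borel X)) x :
  measurable N -> mu N = 0 -> (forall y, ~ N y -> g y = h y) ->
  convolution k r nu g x = convolution k r nu h x.
Proof.
move=> mN N0 gh; rewrite /convolution /charge_integral.
have tv0 : pos_part (nu x) N + neg_part (nu x) N = 0.
  apply/eqP; rewrite eq_le adde_ge0// andbT.
  by apply: (le_trans (filter_domination x mN)); rewrite N0 mule0.
have p0 : pos_part (nu x) N = 0.
  by apply/eqP; rewrite eq_le measure_ge0 andbT -tv0 leeDl.
have n0 : neg_part (nu x) N = 0.
  by apply/eqP; rewrite eq_le measure_ge0 andbT -tv0 leeDr.
by congr (_ - _); apply: (eq_integral_off_null _ mN) => // y /gh ->.
Qed.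

(** Pointwise, Hoelder on the ball of radius [r] bounds the power [p] of the
    convolution by an average of [`|g| `^ p]; one factor [S] comes from
    integrating that average, and [S `^ (p - 1)] from Hoelder. *)
Lemma convolution_Lp_le (g : borel X -> R) (p : R) :
  measurable_fun [set: borel X] g -> (1 <= p)%R ->
  upper_Lp_norm mu p (convolution k r nu g) <=
  (Num.max M 0)%:E * S * 'N[mu]_(p%:E)[EFin \o g].
Proof.
move=> mg p1; set a := (Num.max M 0)%R.
have p0 : (0 < p)%R by lra.
have a0 : 0 <= a%:E by rewrite lee_fin le_max lexx orbT.
have S0 := sup_ball_measure_ge0.
pose f y := `|(g y)%:E| `^ p.
have f0 y : 0 <= f y by exact: poweR_ge0.
have mf : measurable_fun [set: borel X] f.
  apply: (measurableT_comp (measurable_poweR _)); apply: measurableT_comp => //.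
  exact/measurable_EFinP.
have [h [mh fh inth]] := integral_ball_average_le k mu_mm r mf f0.
pose c := a%:E `^ p * S `^ (p - 1).
have c0 : 0 <= c by rewrite mule_ge0// poweR_ge0.
have h0 x : 0 <= h x by apply: le_trans (fh x); exact: integral_ge0.
have mono (u v : \bar R) (s : R) : (0 <= s)%R -> 0 <= u -> u <= v -> u `^ s <= v `^ s.
  move=> s0 u0 uv; apply: gt0_ler_poweR => //; rewrite in_itv /= ?leey ?andbT//.
  exact: le_trans uv.
have step : upper_integral mu (fun x => `|convolution k r nu g x| `^ p) <=
    (a%:E * S) `^ p * \int[mu]_y f y.
  apply: (@le_trans _ _ (\int[mu]_x (c * h x))).
    apply: upper_integral_le; [exact: measurable_funeM|by move=> x; exact: poweR_ge0|].
    move=> x; have I0 : 0 <= \int[mu]_(y in mball k x r) `|(g y)%:E|.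
      exact: integral_ge0.
    apply: le_trans (mono _ _ _ (ltW p0) _ (convolution_le x mg)) _ => //.
    rewrite poweRM// /c -muleA; apply: lee_wpmul2l; first exact: poweR_ge0.
    apply: le_trans (power_mean_le mu (measurable_mball k x r) mg p1) _.
    apply: lee_pmul; [exact: poweR_ge0|by apply: integral_ge0 => y _; exact: f0| |exact: fh].
    by apply: mono => //; [rewrite subr_ge0|exact: ball_measure_le_sup].
  rewrite ge0_integralZl//.
  apply: (@le_trans _ _ (c * (S * \int[mu]_y f y))); first exact: lee_wpmul2l.
  rewrite muleA; apply: lee_wpmul2r; first exact: integral_ge0.
  rewrite /c -muleA poweRM//.
  have -> : S `^ p = S `^ (p - 1) * S.
    rewrite -{3}(poweRe1 S0) -poweRD ?subrK//.
    by apply: add_neq0_poweRD_def; rewrite subrK gt_eqF.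
  by [].
have J0 : 0 <= \int[mu]_y f y by exact: integral_ge0.
rewrite /upper_Lp_norm; apply: (le_trans (mono _ _ (p^-1)%R _ _ step)).
- by rewrite invr_ge0 ltW.
- apply: le_ereal_inf_tmp => _ [l [_ l0] <-]; apply: integral_ge0 => x _.
  by have [] := l0 x.
rewrite poweRM ?poweR_ge0// -poweRrM divff ?gt_eqF// poweRe1; last by rewrite mule_ge0.
by rewrite unlock.
Qed.

Lemma convolution_Loo_le (g : borel X -> R) :
  measurable_fun [set: borel X] g ->
  upper_Loo_norm mu (convolution k r nu g) <=
  (Num.max M 0)%:E * S * 'N[mu]_(+oo)[EFin \o g].
Proof.
move=> mg; have a0 : 0 <= (Num.max M 0)%:E by rewrite lee_fin le_max lexx orbT.
apply: upper_Loo_norm_le; first by rewrite !mule_ge0 ?sup_ball_measure_ge0 ?Lnorm_ge0.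
move=> x; apply: (le_trans (convolution_le x mg)); rewrite -muleA.
apply: lee_wpmul2l => //.
apply: (le_trans (integral_le_Loo_norm mu (measurable_mball k x r) mg)).
by apply: lee_wpmul2r; [exact: Lnorm_ge0|exact: ball_measure_le_sup].
Qed.

End filter_convolution.

Theorem theorem2p12 (R : realType) (X : pmetricType R) (k : ball_kind) (r : R)
    (mu : {measure set (borel X) -> \bar R})
    (nu : X -> {charge set (borel X) -> \bar R}) (M : R)
    (r_gt0 : (0 < r)%R)
    (mu_mm : metric_measure mu)
    (E_fin : equal_radius_besicovitch_constant X k < +oo)
    (nu_filter : signed_ball_filter k r nu)
    (nu_adapted : adapted k r mu nu M)
    (g : X -> R)
    (g_loc : locally_integrable_on_balls k mu g) :
  (forall p : R, (1 <= p)%R ->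
     upper_Lp_norm mu p (convolution k r nu g) <=
     M%:E * sup_ball_measure k r mu
       * (equal_radius_besicovitch_constant X k `^ p^-1)
       * 'N[mu]_(p%:E)[EFin \o g]) /\
  upper_Loo_norm mu (convolution k r nu g) <=
    M%:E * sup_ball_measure k r mu * 'N[mu]_(+oo)[EFin \o g].
Proof.
have [h [N [mh mN N0 gh]]] := completion_measurable_borel g_loc.1.
have -> : convolution k r nu g = convolution k r nu h.
  apply/funext => x.
  exact: (convolution_off_null r_gt0 mu_mm E_fin nu_filter nu_adapted x mN N0 gh).
have normE q : -oo < q -> 'N[mu]_q[EFin \o g] = 'N[mu]_q[EFin \o h].
  by apply: (eq_Lnorm_off_null mN N0) => x /gh /= ->.
rewrite (mule_sup_ball_measure r_gt0 nu_adapted).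
have aS0 : 0 <= (Num.max M 0)%:E * sup_ball_measure k r mu.
  by rewrite mule_ge0 ?sup_ball_measure_ge0// lee_fin le_max lexx orbT.
split=> [p p1|]; last first.
  rewrite normE//.
  exact: (convolution_Loo_le r_gt0 mu_mm E_fin nu_filter nu_adapted).
rewrite normE ?ltNyr//.
apply: (le_trans (convolution_Lp_le r_gt0 mu_mm E_fin nu_filter nu_adapted mh p1)).
apply: lee_wpmul2r; first exact: Lnorm_ge0.
rewrite -[leLHS]mule1; apply: lee_wpmul2l => //.
(* It remains to insert the factor [E `^ p^-1], which is at least 1. *)
have p0 : (0 <= p^-1)%R by rewrite invr_ge0; lra.
rewrite -[leLHS](poweR1r (p^-1)%R); have E1 := besicovitch_constant_ge1 X k.
by apply: gt0_ler_poweR => //; rewrite in_itv /= leey andbT// (le_trans _ E1).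
Qed.
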